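(* Let $k\ge 0$, let $\xi_0,\xi_k\in\Gamma$ (with $\xi_k=\xi_0$ if $k=0$), and let $\bar z^k=(\bar x^k,\bar\lambda^k)\in\Lambda(\xi_k)$ be a given KKT point of $\mathrm{P}(\xi_k)$. Suppose that: (A1) the set $\Lambda(\xi_0)$ of KKT points of $\mathrm{P}(\xi_0)$ is nonempty; (A2) $g$ is twice continuously differentiable on its domain; (A3) there exist a neighborhood $\mathcal N_0\subset\mathbb R^{n+m}$ of the origin and a neighborhood $\mathcal N_{\bar z^k}$ of $\bar z^k$ such that for each $\delta\in\mathcal N_0$ the set $\psi_k(\delta):=\mathcal N_{\bar z^k}\cap L^{-1}(\delta;\xi_k)$ is single-valued (consists of exactly one point), and $\psi_k$ is Lipschitz continuous on $\mathcal N_0$ with a Lipschitz constant $\gamma>0$; (A4) there exists a constant $0\le\kappa<1/\gamma$ such that $\|E_g(\bar z^k)\|_F\le\kappa$, where $E_g(\bar z^k):=\sum_{i=1}^m\bar\lambda^k_i\nabla^2 g_i(\bar x^k)$. Then there exist neighborhoods $\mathcal N_\tau$ of $\xi_k$ and $\mathcal N_\rho$ of $\bar z^k$ and a single-valued function $\bar z:\mathcal N_\tau\to\mathcal N_\rho$ such that for all $\xi_{k+1}\in\mathcal N_\tau$, $\bar z^{k+1}:=\bar z(\xi_{k+1})$ is the unique KKT point of $\mathrm{P}(\xi_{k+1})$ in $\mathcal N_\rho$ (in particular $\Lambda(\xi_{k+1})\ne\emptyset$). Moreover, there exist constants $\omega_k\in(0,1)$ and $c_k>0$ such that for any $\xi_{k+1}\in\mathcal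 N_\tau$ and any $z^k=(x^k,\lambda^k)\in\mathcal N_\rho$, $$\|z^{k+1}-\bar z^{k+1}\|\le\omega_k\|z^k-\bar z^k\|+c_k\|M(\xi_{k+1}-\xi_k)\|,$$ where $z^{k+1}=(x^{k+1},\lambda^{k+1})$ is a KKT point of $\mathrm{P}_{\mathrm{cvx}}(x^k;\xi_{k+1})$.
   Context: Data: $c\in\mathbb R^n$; a function $g:\mathbb R^n\to\mathbb R^m$ with components $g_i$ and Jacobian matrix $g'(x)\in\mathbb R^{m\times n}$; a convex set $\Omega\subseteq\mathbb R^n$; a parameter set $\Gamma\subseteq\mathbb R^p$; a matrix $M\in\mathbb R^{m\times p}$. Parameters range over $\Gamma$, and neighborhoods of a parameter are neighborhoods in $\Gamma$. $\|\cdot\|$ is the $L_2$-norm (Euclidean norm) and $\|\cdot\|_F$ the Frobenius norm. Write $z=(x,\lambda)\in\mathbb R^n\times\mathbb R^m$. For $\xi\in\Gamma$, the problem $\mathrm{P}(\xi)$ is: $\min_x c^Tx$ subject to $g(x)+M\xi=0$, $x\in\Omega$. Normal cones: for a convex set $C$, $N_C(x):=\{u: u^T(v-x)\le 0\ \forall v\in C\}$ if $x\in C$, and $N_C(x):=\emptyset$ if $x\notin C$. Put $K:=\Omega\times\mathbb R^m$, so $N_K(x,\lambda)=N_\Omega(x)\times\{0\}$. A pair $(x,\lambda)$ is a KKT point of $\mathrm{P}(\xi)$ if $0\in c+g'(x)^T\lambda+N_\Omega(x)$ and $g(x)+M\xi=0$. $\Lambda(\xi)$ denotes the set of KKT points of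 $\mathrm{P}(\xi)$. For $\hat x\in\mathbb R^n$ and $\xi\in\Gamma$, the convex subproblem $\mathrm{P}_{\mathrm{cvx}}(\hat x;\xi)$ is: $\min_x c^Tx$ subject to $g'(\hat x)(x-\hat x)+g(\hat x)+M\xi=0$, $x\in\Omega$. With $$\hat\varphi(z;\hat x,\xi):=\begin{pmatrix}c+g'(\hat x)^T\lambda\\ g(\hat x)+g'(\hat x)(x-\hat x)+M\xi\end{pmatrix},$$ a pair $z=(x,\lambda)$ is a KKT point of $\mathrm{P}_{\mathrm{cvx}}(\hat x;\xi)$ if $0\in\hat\varphi(z;\hat x,\xi)+N_K(z)$. For the given KKT point $\bar z^k=(\bar x^k,\bar\lambda^k)\in\Lambda(\xi_k)$, define the set-valued mapping $L(z;\xi):=\hat\varphi(z;\bar x^k,\xi)+N_K(z)$ and its inverse $L^{-1}(\delta;\xi):=\{z\in\mathbb R^{n+m}:\delta\in L(z;\xi)\}$ for $\delta\in\mathbb R^{n+m}$. *)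

(* Defs.v *)
From HB Require Import structures.
From mathcomp Require Import all_boot all_order all_algebra.
From mathcomp Require Import all_classical all_reals all_analysis.

Set Implicit Arguments.
Unset Strict Implicit.
Unset Printing Implicit Defensive.

Import Order.TTheory GRing.Theory Num.Theory.
Import numFieldNormedType.Exports.

Local Open Scope classical_set_scope.
Local Open Scope ring_scope.

(* Vectors are columns.  The library norm on matrices
   is the sup norm, hence the two norms below; the library topology (nbhs) on
   'cV[R]_d is the usual one on R^d. *)

Section norms.
Context {R : realType}.

Definition l2norm {d : nat} (v : 'cV[R]_d) : R :=
  Num.sqrt (\sum_(i < d) v i 0 ^+ 2).

Definition frobenius_norm {p q : nat} (A : 'M[R]_(p, q)) : R :=
  Num.sqrt (\sum_(i < p) \sum_(j < q) A i j ^+ 2).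

End norms.

Section calculus.
Context {R : realType}.

Definition partial {n : nat} (j : 'I_n) (f : 'cV[R]_n -> R) (x : 'cV[R]_n) : R :=
  'D_(delta_mx j 0) f x.

Definition component {n m : nat} (g : 'cV[R]_n -> 'cV[R]_m) (i : 'I_m)
  (x : 'cV[R]_n) : R := g x i 0.

(* The library's [jacobian] acts on row vectors and is the transpose of this. *)
Definition Jac {n m : nat} (g : 'cV[R]_n -> 'cV[R]_m) (x : 'cV[R]_n) :
  'M[R]_(m, n) := \matrix_(i < m, j < n) partial j (component g i) x.

Definition hessian {n : nat} (f : 'cV[R]_n -> R) (x : 'cV[R]_n) : 'M[R]_n :=
  \matrix_(i < n, j < n) partial i (partial j f) x.

Definition C1 {n : nat} (f : 'cV[R]_n -> R) : Prop :=
  (forall x, differentiable f x) /\ (forall j, continuous (partial j f)).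

Definition C2 {n : nat} (f : 'cV[R]_n -> R) : Prop :=
  C1 f /\ (forall j, C1 (partial j f)).

End calculus.

Section problem.
Context {R : realType} {n m p : nat}.
Variables (c : 'cV[R]_n) (g : 'cV[R]_n -> 'cV[R]_m).
Variables (Omega : set 'cV[R]_n) (M : 'M[R]_(m, p)).
Implicit Types (x : 'cV[R]_n) (lam : 'cV[R]_m) (z : 'cV[R]_(n + m)).
Implicit Types (xi : 'cV[R]_p).

Definition normal_cone {d : nat} (C : set 'cV[R]_d) (x : 'cV[R]_d) :
  set 'cV[R]_d :=
  [set u | C x /\ forall v, C v -> (u^T *m (v - x)) 0 0 <= 0].

(* A pair z = (x, lam) in R^n x R^m is the vector [col_mx x lam] of R^(n+m);
   its components are [usubmx z] and [dsubmx z]. *)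
Definition Kset : set 'cV[R]_(n + m) := [set z | Omega (usubmx z)].

(* Lambda(xi): KKT points of  min c^T x  s.t.  g x + M xi = 0, x in Omega. *)
Definition KKT xi : set 'cV[R]_(n + m) :=
  [set z | [set c + (Jac g (usubmx z))^T *m dsubmx z + u
             | u in normal_cone Omega (usubmx z)] 0 /\
           g (usubmx z) + M *m xi = 0].

Definition phi_hat z (xhat : 'cV[R]_n) xi : 'cV[R]_(n + m) :=
  col_mx (c + (Jac g xhat)^T *m dsubmx z)
         (g xhat + Jac g xhat *m (usubmx z - xhat) + M *m xi).

(* The set phi_hat(z; xhat, xi) + N_K(z). *)
Definition Lmap (xhat : 'cV[R]_n) z xi : set 'cV[R]_(n + m) :=
  [set phi_hat z xhat xi + u | u in normal_cone Kset z].

(* KKT points of the convex subproblem P_cvx(xhat; xi). *)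
Definition KKT_cvx (xhat : 'cV[R]_n) xi : set 'cV[R]_(n + m) :=
  [set z | Lmap xhat z xi 0].

Definition Linv (xhat : 'cV[R]_n) (delta : 'cV[R]_(n + m)) xi :
  set 'cV[R]_(n + m) := [set z | Lmap xhat z xi delta].

(* N0 and Nz are the two neighborhoods, psi the single-valued localization
   of delta |-> Linv xbar delta xi. *)
Definition strong_regularity (zbar : 'cV[R]_(n + m)) xi (gamma : R) : Prop :=
  exists (N0 Nz : set 'cV[R]_(n + m)) (psi : 'cV[R]_(n + m) -> 'cV[R]_(n + m)),
    [/\ nbhs (0 : 'cV[R]_(n + m)) N0, nbhs zbar Nz,
        forall delta, N0 delta ->
          Nz `&` Linv (usubmx zbar) delta xi = [set psi delta] &
        forall delta delta', N0 delta -> N0 delta' ->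
          l2norm (psi delta - psi delta') <= gamma * l2norm (delta - delta')].

Definition E_g z : 'M[R]_n :=
  \sum_(i < m) dsubmx z i 0 *: hessian (component g i) (usubmx z).

End problem.

(* Main.v *)
Require Import Defs.
From HB Require Import structures.
From mathcomp Require Import all_boot all_order all_algebra.
From mathcomp Require Import all_classical all_reals all_analysis.
From mathcomp Require Import ring lra.

Set Implicit Arguments.
Unset Strict Implicit.
Unset Printing Implicit Defensive.

Import Order.TTheory GRing.Theory Num.Theory.
Import numFieldNormedType.Exports.

Local Open Scope classical_set_scope.
Local Open Scope ring_scope.

(** The proof is Robinson's perturbation argument for generalized equations.
    Write xbar for the first block of the reference point zbark and
      D x xi z = phi_hat(z; xbar, xik) - phi_hat(z; x, xi).
    Then z is a KKT point of the convex subproblem P_cvx(x; xi) exactly when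
    D x xi z belongs to L(z; xik) ([KKT_cvx_Linv]), and z is a KKT point of
    P(xi) exactly when it is one of the subproblem linearized at its own first
    block ([KKT_KKT_cvx]).  Near zbark the localization psi turns the two
    inclusions into the fixed point equations
      z = psi (D x xi z)   and   z = psi (D (usubmx z) xi z).

    The map D is controlled by two estimates ([phi_hat_estimates]).  Moving z
    changes D by little, since the Jacobian at x is close to the Jacobian at
    xbar.  Moving the linearization point x changes phi_hat at a rate close to
    the norm of E_g(zbark): in the first block the derivative in x of
    g'(x)^T lambda at zbark is the transpose of E_g(zbark), and in the second
    block the derivative of g(x) + g'(x)(y - x) in x vanishes at x = y.  So,
    for an arbitrarily small eps, D x xi is eps-Lipschitz in z and
    z |-> D (usubmx z) xi z is (kappa + 2 eps)-Lipschitz; as psi is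
    gamma-Lipschitz and gamma * kappa < 1, both right-hand sides are
    contractions of one ball around zbark ([localization_perturbation]).
    This gives existence and local uniqueness for both problems.

    The error bound has to hold for every KKT point of the subproblem, not only
    for those in the ball.  The KKT set of the subproblem is convex
    ([KKT_cvx_segment]) and its point in the ball is interior to the ball, so
    it is the only one ([convex_unique]).  Subtracting the two fixed point
    equations, with zk and xk the current iterate and its first block, gives
      |z - zbar| <= gamma (eps |z - zbar| + (kappa + eps) |xbar(xi) - xk|),
    where xbar(xi) is the first block of zbar = zbar(xi), and
    |zbar - zbark| is bounded by a multiple of |M (xi - xik)| in the same way;
    the triangle inequality through zbark concludes. *)

(** * The Euclidean and Frobenius norms *)

Section euclidean_norm.
Context {R : realType}.

Lemma sum_sqr_ge0 (I : finType) (a : I -> R) : 0 <= \sum_i a i ^+ 2.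
Proof. by apply: sumr_ge0 => i _; exact: sqr_ge0. Qed.

(** Lagrange's identity: twice the defect is the double sum of
    (a i * b j - a j * b i)^2. *)
Lemma sum_mul_sqr_le (I : finType) (a b : I -> R) :
  (\sum_i a i * b i) ^+ 2 <= (\sum_i a i ^+ 2) * (\sum_i b i ^+ 2).
Proof.
have : 0 <= \sum_i \sum_j (a i * b j - a j * b i) ^+ 2.
  by apply: sumr_ge0 => i _; exact: sum_sqr_ge0.
have -> : \sum_i \sum_j (a i * b j - a j * b i) ^+ 2 =
    ((\sum_i a i ^+ 2) * (\sum_i b i ^+ 2) - (\sum_i a i * b i) ^+ 2) *+ 2.
  have exp2 i j : (a i * b j - a j * b i) ^+ 2 =
    a i ^+ 2 * b j ^+ 2 + b i ^+ 2 * a j ^+ 2 - (a i * b i) * (a j * b j) *+ 2.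
    ring.
  under eq_bigr do under eq_bigr do rewrite exp2.
  under eq_bigr do rewrite big_split /= big_split /= sumrN sumrMnl -!mulr_sumr.
  rewrite big_split /= big_split /= sumrN sumrMnl -!mulr_suml.
  ring.
by rewrite pmulrn_lge0// subr_ge0.
Qed.

Lemma l2norm_ge0 d (v : 'cV[R]_d) : 0 <= l2norm v.
Proof. exact: sqrtr_ge0. Qed.

Lemma frobenius_norm_ge0 p q (A : 'M[R]_(p, q)) : 0 <= frobenius_norm A.
Proof. exact: sqrtr_ge0. Qed.

Lemma l2norm_sqr d (v : 'cV[R]_d) : l2norm v ^+ 2 = \sum_i v i 0 ^+ 2.
Proof. by rewrite sqr_sqrtr// sum_sqr_ge0. Qed.

Lemma frobenius_norm_sqr p q (A : 'M[R]_(p, q)) :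
  frobenius_norm A ^+ 2 = \sum_i \sum_j A i j ^+ 2.
Proof. by rewrite sqr_sqrtr// sumr_ge0// => i _; exact: sum_sqr_ge0. Qed.

Lemma frobenius_norm_tr p q (A : 'M[R]_(p, q)) :
  frobenius_norm A^T = frobenius_norm A.
Proof.
rewrite /frobenius_norm exchange_big /=; congr Num.sqrt.
by apply: eq_bigr => i _; apply: eq_bigr => j _; rewrite mxE.
Qed.

Lemma l2norm0 d : l2norm (0 : 'cV[R]_d) = 0.
Proof. by rewrite /l2norm big1 ?sqrtr0// => i _; rewrite mxE expr0n. Qed.

Lemma l2normN d (v : 'cV[R]_d) : l2norm (- v) = l2norm v.
Proof. by congr Num.sqrt; apply: eq_bigr => i _; rewrite mxE sqrrN. Qed.

Lemma l2distC d (u v : 'cV[R]_d) : l2norm (u - v) = l2norm (v - u).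
Proof. by rewrite -l2normN opprB. Qed.

Lemma l2normZ d (t : R) (v : 'cV[R]_d) : l2norm (t *: v) = `|t| * l2norm v.
Proof.
rewrite /l2norm -sqrtr_sqr -sqrtrM ?sqr_ge0// mulr_sumr.
by congr Num.sqrt; apply: eq_bigr => i _; rewrite mxE exprMn.
Qed.

Lemma l2normD d (u v : 'cV[R]_d) : l2norm (u + v) <= l2norm u + l2norm v.
Proof.
rewrite -(ler_pXn2r (n := 2))// ?nnegrE ?addr_ge0 ?l2norm_ge0//.
have uv : \sum_i u i 0 * v i 0 <= l2norm u * l2norm v.
  apply: le_trans (ler_norm _) _.
  rewrite -(ler_pXn2r (n := 2))// ?nnegrE ?mulr_ge0 ?l2norm_ge0//.
  by rewrite real_normK ?num_real// exprMn !l2norm_sqr sum_mul_sqr_le.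
rewrite sqrrD !l2norm_sqr; under eq_bigr do rewrite mxE sqrrD.
by rewrite !big_split/= lerD2r lerD2l mulr2n lerD.
Qed.

Lemma l2dist_triangle d (w u v : 'cV[R]_d) :
  l2norm (u - v) <= l2norm (u - w) + l2norm (w - v).
Proof. by apply: le_trans (l2normD _ _); rewrite subrKA. Qed.

Lemma entry_le_l2norm d (v : 'cV[R]_d) i : `|v i 0| <= l2norm v.
Proof.
rewrite -sqrtr_sqr ler_wsqrtr// (bigD1 i)//= lerDl.
by apply: sumr_ge0 => j _; exact: sqr_ge0.
Qed.

Lemma norm_le_l2norm d (v : 'cV[R]_d) : `|v| <= l2norm v.
Proof.
rewrite [leLHS]/Num.norm /= mx_normrE; apply/bigmax_leP; split.
  exact: l2norm_ge0.
by move=> -[i j] _ /=; rewrite ord1; exact: entry_le_l2norm.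
Qed.

Lemma entry_le_norm d (v : 'cV[R]_d) i : `|v i 0| <= `|v|.
Proof.
rewrite [leRHS]/Num.norm /= mx_normrE; apply/bigmax_geP; right.
by exists (i, 0).
Qed.

Lemma l2norm_le_sum d (v : 'cV[R]_d) : l2norm v <= \sum_i `|v i 0|.
Proof.
have S0 (P : pred 'I_d) : 0 <= \sum_(i | P i) `|v i 0| by apply: sumr_ge0.
rewrite -(ler_pXn2r (n := 2))// ?nnegrE ?l2norm_ge0 ?S0//.
rewrite l2norm_sqr expr2 mulr_suml ler_sum// => i _.
rewrite -(real_normK (num_real _)) expr2 ler_wpM2l//.
by rewrite (bigD1 i)//= lerDl.
Qed.

Lemma l2norm_le_norm d (v : 'cV[R]_d) : l2norm v <= d%:R * `|v|.
Proof.
apply: le_trans (l2norm_le_sum v) _.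
rewrite mulr_natl -[X in _ *+ X]card_ord -sumr_const ler_sum// => i _.
exact: entry_le_norm.
Qed.

Lemma l2norm_eq0 d (v : 'cV[R]_d) : l2norm v <= 0 -> v = 0.
Proof.
by move=> v0; apply/normr0_eq0/le_anti; rewrite normr_ge0 (le_trans (norm_le_l2norm v)).
Qed.

Lemma l2norm_mulmx p q (A : 'M[R]_(p, q)) (v : 'cV[R]_q) :
  l2norm (A *m v) <= frobenius_norm A * l2norm v.
Proof.
rewrite -(ler_pXn2r (n := 2))// ?nnegrE ?mulr_ge0 ?frobenius_norm_ge0 ?l2norm_ge0//.
rewrite exprMn !l2norm_sqr frobenius_norm_sqr mulr_suml ler_sum// => i _.
by rewrite mxE sum_mul_sqr_le.
Qed.

Lemma l2norm_col_mx n m (u : 'cV[R]_n) (v : 'cV[R]_m) :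
  l2norm (col_mx u v) ^+ 2 = l2norm u ^+ 2 + l2norm v ^+ 2.
Proof.
rewrite !l2norm_sqr big_split_ord /=; congr (_ + _).
  by apply: eq_bigr => i _; rewrite col_mxEu.
by apply: eq_bigr => i _; rewrite col_mxEd.
Qed.

Lemma l2norm_col_mx0 n m (u : 'cV[R]_n) :
  l2norm (col_mx u (0 : 'cV[R]_m)) = l2norm u.
Proof.
apply/eqP; rewrite -(eqrXn2 (n := 2)) ?l2norm_ge0//.
by rewrite l2norm_col_mx l2norm0 expr0n addr0.
Qed.

Lemma l2norm_col_0mx n m (v : 'cV[R]_m) :
  l2norm (col_mx (0 : 'cV[R]_n) v) = l2norm v.
Proof.
apply/eqP; rewrite -(eqrXn2 (n := 2)) ?l2norm_ge0//.
by rewrite l2norm_col_mx l2norm0 expr0n add0r.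
Qed.

Lemma l2norm_usubmx n m (z : 'cV[R]_(n + m)) : l2norm (usubmx z) <= l2norm z.
Proof.
rewrite -(ler_pXn2r (n := 2))// ?nnegrE ?l2norm_ge0//.
by rewrite -[in leRHS](vsubmxK z) l2norm_col_mx lerDl sqr_ge0.
Qed.

(** The off-diagonal blocks A^T and A act on orthogonal components. *)
Lemma l2norm_col_mx_mulmx n m (A : 'M[R]_(m, n)) (z : 'cV[R]_(n + m)) :
  l2norm (col_mx (A^T *m dsubmx z) (A *m usubmx z)) <=
  frobenius_norm A * l2norm z.
Proof.
rewrite -(ler_pXn2r (n := 2))// ?nnegrE ?mulr_ge0 ?frobenius_norm_ge0 ?l2norm_ge0//.
rewrite exprMn -[in leRHS](vsubmxK z) !l2norm_col_mx mulrDr addrC -!exprMn.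
by rewrite lerD// ler_pXn2r// ?nnegrE ?mulr_ge0 ?frobenius_norm_ge0 ?l2norm_ge0//
  ?l2norm_mulmx// -(frobenius_norm_tr A) l2norm_mulmx.
Qed.

(** Euclidean balls generate the sup-norm topology of the matrix spaces. *)
Lemma nbhs_l2ball d (v : 'cV[R]_d) (A : set 'cV[R]_d) :
  nbhs v A <-> exists2 r, 0 < r & forall w, l2norm (w - v) <= r -> A w.
Proof.
split.
  move=> /nbhs_normP[e /= e0 eA]; exists (e / 2); first by rewrite divr_gt0.
  move=> w wv; apply: eA => /=; rewrite distrC.
  apply: le_lt_trans (norm_le_l2norm _) _; apply: le_lt_trans wv _.
  by rewrite ltr_pdivrMr// ltr_pMr// ltr1n.
move=> [r r0 rA]; apply/nbhs_ballP; exists (r / d.+1%:R) => /=.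
  by rewrite divr_gt0.
move=> w; rewrite -ball_normE /= distrC ltr_pdivlMr// => wv; apply: rA.
apply: le_trans (l2norm_le_norm _) _; apply: le_trans (ltW wv).
by rewrite mulrC ler_wpM2l// ler_nat.
Qed.

End euclidean_norm.

(** * Strict differentiability of C1 functions *)

Section landau_products.
Context {R : realType} {T : Type} {V : normedModType R}.
Variables (F : filter_on T) (e : T -> V).

Lemma littleo_sum (I : finType) (f : I -> T -> R) :
  (forall i, f i =o_F e) -> (fun w => \sum_i f i w) =o_F e.
Proof.
move=> fo; apply/eqoP => eps eps0.
have d0 : 0 < eps / #|I|.+1%:R by rewrite divr_gt0.
have H : \forall w \near F, forall i, `|f i w| <= eps / #|I|.+1%:R * `|e w|.
  by apply: filter_forall => i; move/eqoP: (fo i); exact.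
apply: filterS H => w H; apply: le_trans (ler_norm_sum _ _ _) _.
apply: le_trans (ler_sum _ (fun i _ => H i)) _.
rewrite sumr_const -[leLHS]mulr_natl mulrA ler_wpM2r//.
by rewrite mulrCA ler_piMr ?(ltW eps0)// ler_pdivrMr// mul1r ler_nat ltnW.
Qed.

Lemma littleoD (f h : T -> R) :
  f =o_F e -> h =o_F e -> (fun w => f w + h w) =o_F e.
Proof.
move=> /eqoP fo /eqoP ho; apply/eqoP => eps eps0.
near=> w; rewrite (splitr eps) mulrDl (le_trans (ler_normD _ _))// lerD//.
  by near: w; apply: fo; rewrite divr_gt0.
by near: w; apply: ho; rewrite divr_gt0.
Unshelve. all: by end_near. Qed.

Lemma littleoMl (a : R) (f : T -> R) :
  f =o_F e -> (fun w => a * f w) =o_F e.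
Proof.
move=> /eqoP fo; apply/eqoP => eps eps0.
near=> w; have fw : `|f w| <= eps / (`|a| + 1) * `|e w|.
  by near: w; apply: fo; rewrite divr_gt0// ltr_wpDl.
rewrite normrM (le_trans (ler_wpM2l _ fw))// mulrA ler_wpM2r//.
by rewrite mulrCA ler_piMr ?(ltW eps0)// ler_pdivrMr ?ltr_wpDl// mul1r lerDl.
Unshelve. all: by end_near. Qed.

(** The product rule o(1) * O(e) = o(e): it absorbs a continuous factor that
    vanishes at the reference point times a locally Lipschitz increment. *)
Lemma cvg0_bigO_littleo (f h : T -> R) :
  f @ F --> (0 : R) -> h =O_F e -> (fun w => f w * h w) =o_F e.
Proof.
move=> f0 /eqO_exP[C C0 hC]; apply/eqoP => eps eps0.
have f_small : \forall w \near F, `|f w| <= eps / C.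
  have /cvgr0Pnorm_le : f @ F --> (0 : R) by [].
  by apply; rewrite divr_gt0.
near=> w; rewrite normrM.
have fw : `|f w| <= eps / C by near: w.
have hw : `|h w| <= C * `|e w| by near: w.
by rewrite (le_trans (ler_pM _ _ fw hw))// mulrA divfK ?gt_eqF.
Unshelve. all: by end_near. Qed.

Lemma littleo_bigO_add (f h : T -> R) :
  (fun w => f w - h w) =o_F e -> h =O_F e -> f =O_F e.
Proof.
move=> /eqoP /(_ 1 ltr01) fh /eqO_exP[C C0 hC].
apply/eqO_exP; exists (1 + C); first by rewrite addr_gt0.
near=> w; rewrite -(subrK (h w) (f w)) (le_trans (ler_normD _ _))// mulrDl lerD//.
  by near: w.
by near: w.
Unshelve. all: by end_near. Qed.

Lemma coord_bigO d (e' : T -> 'cV[R]_d) (i : 'I_d) :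
  (fun w => e' w i 0) =O_F e'.
Proof.
by apply/eqO_exP; exists 1 => //; near=> w; rewrite mul1r entry_le_norm.
Unshelve. all: by end_near. Qed.

End landau_products.

Lemma l2norm_littleo {R : realType} {T : Type} (F : filter_on T)
    d n (f : T -> 'cV[R]_d) (e : T -> 'cV[R]_n) :
  (forall i, (fun w => f w i 0) =o_F e) ->
  forall eps, 0 < eps -> \forall w \near F, l2norm (f w) <= eps * l2norm (e w).
Proof.
move=> fo eps eps0.
have /eqoP/(_ _ eps0) : (fun w => \sum_i `|f w i 0|) =o_F e.
  apply: littleo_sum => i; apply/eqoP => d0 d00; near=> w; rewrite normr_id.
  by near: w; move/eqoP: (fo i); exact.
apply: filterS => w fw; apply: le_trans (l2norm_le_sum _) _.
apply: le_trans (ler_norm _) (le_trans fw _).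
by rewrite ler_wpM2l ?(ltW eps0)// norm_le_l2norm.
Unshelve. all: by end_near. Qed.

Section strict_differentiability.
Context {R : realType} {n : nat}.

Lemma diff_partial (f : 'cV[R]_n -> R) (x h : 'cV[R]_n) :
  differentiable f x -> 'd f x h = \sum_j partial j f x * h j 0.
Proof.
move=> df; rewrite {1}(matrix_sum_delta h) linear_sum; apply: eq_bigr => j _.
by rewrite big_ord1 linearZ /= /partial deriveE// mulrC.
Qed.

Lemma mean_value (f : 'cV[R]_n -> R) (u v : 'cV[R]_n) :
  (forall x, differentiable f x) ->
  exists2 t, 0 <= t <= 1 &
    f u - f v = \sum_j partial j f (v + t *: (u - v)) * (u - v) j 0.
Proof.
move=> df; set h := u - v.
pose line (t : R) := v + t *: h.
have dline (t : R) : is_diff t line ( *:%R^~ h).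
  rewrite -[X in is_diff _ _ X]add0r.
  exact: (is_diffD (is_diff_cst v t) (is_diff_scalel t h)).
have dphi (t : R) : is_derive t (1 : R) (f \o line)
    (\sum_j partial j f (line t) * h j 0).
  have dc : is_diff t (f \o line) ('d f (line t) \o ( *:%R^~ h)).
    have ? : is_diff (line t) f ('d f (line t)) by exact: differentiableP.
    exact: is_diff_comp.
  apply: DeriveDef; first exact: diff_derivable.
  by rewrite deriveE// diff_val /= scale1r diff_partial.
have [|t] := @MVT_segment R (f \o line) _ 0 1 ler01 (fun t _ => dphi t).
  apply: continuous_subspaceT => t; apply: differentiable_continuous.
  by apply/derivable1_diffP; exact: ex_derive.
rewrite in_itv /= /line scale1r scale0r addr0 subr0 mulr1 (_ : v + h = u) => [t01 E|].
  by exists t.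
by rewrite /h addrC subrK.
Qed.

(** By the mean value theorem the error is (f'(y) - f'(x0)) (u - v) for some y
    between u and v, and f' is continuous at x0. *)
Lemma C1_strict_diff (f : 'cV[R]_n -> R) (x0 : 'cV[R]_n) T (F : filter_on T)
    (u v : T -> 'cV[R]_n) :
  C1 f -> u @ F --> x0 -> v @ F --> x0 ->
  (fun w => f (u w) - f (v w) - \sum_j partial j f x0 * (u w - v w) j 0)
    =o_F (fun w => u w - v w).
Proof.
move=> [df cf] ux vx; apply/eqoP => eps eps0.
have e0 : 0 < eps / n.+1%:R by rewrite divr_gt0.
have near_cont : \forall y \near x0, forall j,
    `|partial j f x0 - partial j f y| <= eps / n.+1%:R.
  apply: (@filter_forall _ _ _ _ (nbhs_filter x0)) => j.
  by have /cvgr_dist_le := cf j x0; exact.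
have [r /= r0 rP] := (iffLR (nbhs_ballP _ _)) near_cont.
near=> w.
have [t /andP[t0 t1] ->] := mean_value (u w) (v w) df.
set h := u w - v w; set y := v w + t *: h.
have yr : ball x0 r y.
  rewrite -ball_normE /=.
  have -> : x0 - y = t *: (x0 - u w) + (1 - t) *: (x0 - v w).
    rewrite /y /h !scalerBr !scalerBl !scale1r.
    by apply/colP => i; rewrite !mxE; ring.
  apply: le_lt_trans (ler_normD _ _) _; rewrite !normrZ.
  have ur : `|x0 - u w| < r by near: w; exact: cvgr_dist_lt.
  have vr : `|x0 - v w| < r by near: w; exact: cvgr_dist_lt.
  have t1' : 0 <= 1 - t by rewrite subr_ge0.
  rewrite (ger0_norm t0) (ger0_norm t1').
  apply: (@le_lt_trans _ _ (Num.max `|x0 - u w| `|x0 - v w|)); last first.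
    by rewrite gt_max ur vr.
  rewrite -[leRHS]mul1r -[in leRHS](subrK t 1) [leRHS]mulrDl [leRHS]addrC.
  by rewrite lerD// ler_wpM2l// le_max lexx ?orbT.
rewrite -sumrB; under eq_bigr do rewrite -mulrBl.
apply: le_trans (ler_norm_sum _ _ _) _.
have -> : eps * `|h| = \sum_(j < n.+1) eps / n.+1%:R * `|h|.
  by rewrite sumr_const card_ord -[RHS]mulr_natl mulrA mulrC; field.
rewrite big_ord_recl /= ler_wpDl ?(mulr_ge0 (ltW e0))// ler_sum// => j _.
by rewrite normrM ler_pM// ?entry_le_norm// distrC; exact: rP.
Unshelve. all: by end_near. Qed.

(** Up to o(u - v) the increment is that of the derivative at x0, which is a
    bounded linear map. *)
Lemma C1_bigO (f : 'cV[R]_n -> R) (x0 : 'cV[R]_n) T (F : filter_on T)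
    (u v : T -> 'cV[R]_n) :
  C1 f -> u @ F --> x0 -> v @ F --> x0 ->
  (fun w => f (u w) - f (v w)) =O_F (fun w => u w - v w).
Proof.
move=> Cf ux vx; apply: littleo_bigO_add (C1_strict_diff Cf ux vx) _.
apply/eqO_exP; exists (1 + \sum_j `|partial j f x0|).
  by rewrite ltr_pwDl// sumr_ge0.
near=> w; rewrite mulrDl mul1r ler_wpDl// mulr_suml.
apply: le_trans (ler_norm_sum _ _ _) _; apply: ler_sum => j _.
by rewrite normrM ler_wpM2l// entry_le_norm.
Unshelve. all: by end_near. Qed.

End strict_differentiability.

(** * Contractions for the Euclidean norm *)

(* Makes matrices a completeNormedModType, as Banach's theorem requires. *)
HB.instance Definition _ (R : realType) (m n : nat) := Complete.on 'M[R]_(m, n).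

Section euclidean_fixed_point.
Context {R : realType}.

Definition l2ball {d : nat} (z : 'cV[R]_d) (r : R) : set 'cV[R]_d :=
  [set w | l2norm (w - z) <= r].

Lemma closed_l2ball d (z : 'cV[R]_d) r : closed (l2ball z r).
Proof.
rewrite -[l2ball z r]setCK closedC openE => w /negP; rewrite -ltNge => wz.
apply/nbhs_l2ball; exists ((l2norm (w - z) - r) / 2).
  by rewrite divr_gt0// subr_gt0.
move=> v vw; apply/negP; rewrite -ltNge.
have := l2dist_triangle v w z; rewrite (l2distC w v); lra.
Qed.

(** Banach's fixed point theorem for the Euclidean norm.  A contraction for
    this norm need not contract the sup norm, but a high power of it does, and
    a fixed point of a power of a contraction is fixed by the contraction. *)
Lemma l2_fixed_point d (z0 : 'cV[R]_d) (r q : R) (f : 'cV[R]_d -> 'cV[R]_d) :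
  0 <= r -> 0 <= q -> q < 1 ->
  (forall z, l2ball z0 r z -> l2ball z0 r (f z)) ->
  (forall z w, l2ball z0 r z -> l2ball z0 r w ->
     l2norm (f z - f w) <= q * l2norm (z - w)) ->
  exists2 z, l2ball z0 r z & z = f z.
Proof.
move=> r0 q0 q1 fB flip.
have iterB N z : l2ball z0 r z -> l2ball z0 r (iter N f z).
  by move=> Bz; elim: N => //= N; exact: fB.
have iter_lip N z w : l2ball z0 r z -> l2ball z0 r w ->
    l2norm (iter N f z - iter N f w) <= q ^+ N * l2norm (z - w).
  move=> Bz Bw; elim: N => [|N IH] /=; first by rewrite expr0 mul1r.
  apply: le_trans (flip _ _ (iterB N z Bz) (iterB N w Bw)) _.
  by rewrite exprS -mulrA ler_wpM2l.
have [N qN] : exists N, q ^+ N * d.+1%:R < 1.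
  have : \forall n \near \oo, `|q ^+ n| < d.+1%:R^-1.
    have /cvgr0Pnorm_lt : (fun n => q ^+ n) @ \oo --> (0 : R).
      by apply: cvg_expr; rewrite ger0_norm.
    by apply; rewrite invr_gt0.
  move=> [N _ /(_ N (leqnn N))]; rewrite ger0_norm ?exprn_ge0// => qN.
  by exists N; rewrite -ltr_pdivlMr// div1r.
have fN : {homo iter N f : z / l2ball z0 r z >-> l2ball z0 r z} by exact: iterB.
have q'0 : 0 <= q ^+ N * d.+1%:R by rewrite mulr_ge0// exprn_ge0.
have [|||z Bz zN] := @banach_fixed_point R 'cV[R]_d (l2ball z0 r) (mkfun_fun fN).
- exists (NngNum q'0); split => //= -[z w] [/= Bz Bw].
  apply: le_trans (norm_le_l2norm _) _; apply: le_trans (iter_lip N _ _ Bz Bw) _.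
  rewrite -mulrA ler_wpM2l ?exprn_ge0//; apply: le_trans (l2norm_le_norm _) _.
  by rewrite ler_wpM2r// ler_nat.
- exact: closed_l2ball.
- by exists z0; rewrite /l2ball /= subrr l2norm0.
exists z => //; apply/subr0_eq/l2norm_eq0.
have qN1 : q ^+ N < 1.
  by apply: le_lt_trans qN; rewrite ler_peMr ?exprn_ge0// ler1n.
have := iter_lip N _ _ Bz (fB z Bz).
rewrite -iterSr iterS -[X in l2norm (X - _)]zN -[X in f X]zN.
have := l2norm_ge0 (z - f z); nra.
Qed.

End euclidean_fixed_point.

(** * The generalized equation and convexity of its solution set *)

(** Local uniqueness propagates in a set that contains, with two points, the
    segment between them: a second point would produce others arbitrarily
    close to the first. *)
Lemma convex_unique {R : realType} d (S : set 'cV[R]_d) (z0 z : 'cV[R]_d) (r : R) :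
  (forall w w', S w -> S w' -> forall t, 0 <= t <= 1 -> S (w + t *: (w' - w))) ->
  S z -> l2norm (z - z0) < r ->
  (forall w, S w -> l2ball z0 r w -> w = z) -> forall w, S w -> w = z.
Proof.
move=> convS Sz zr uniq w Sw.
set s := l2norm (w - z); have s0 : 0 <= s by exact: l2norm_ge0.
pose t := Num.min 1 ((r - l2norm (z - z0)) / (s + 1)).
have t0 : 0 < t.
  by rewrite lt_min ltr01 divr_gt0 ?subr_gt0// ltr_wpDl.
have t1 : t <= 1 by rewrite ge_min lexx.
have ts : t * s <= r - l2norm (z - z0).
  have : t <= (r - l2norm (z - z0)) / (s + 1) by rewrite ge_min lexx orbT.
  rewrite ler_pdivlMr ?ltr_wpDl// => ts; apply: le_trans ts.
  by rewrite ler_pM2l// lerDl.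
have /eqP : z + t *: (w - z) = z.
  apply: uniq; first by apply: convS => //; rewrite t1 ltW.
  rewrite /l2ball /= addrAC; apply: le_trans (l2normD _ _) _.
  by rewrite l2normZ (ger0_norm (ltW t0)) -lerBrDl.
rewrite -subr_eq0 addrAC subrr add0r scaler_eq0 gt_eqF//= subr_eq0.
by move/eqP.
Qed.

Section kkt.
Context {R : realType} {n m p : nat}.
Variables (c : 'cV[R]_n) (g : 'cV[R]_n -> 'cV[R]_m).
Variables (Omega : set 'cV[R]_n) (M : 'M[R]_(m, p)).
Implicit Types (x : 'cV[R]_n) (z : 'cV[R]_(n + m)) (xi : 'cV[R]_p).

Let usubmxB (z z' : 'cV[R]_(n + m)) : usubmx (z - z') = usubmx z - usubmx z'.
Proof. exact: linearB. Qed.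

Let dsubmxB (z z' : 'cV[R]_(n + m)) : dsubmx (z - z') = dsubmx z - dsubmx z'.
Proof. exact: linearB. Qed.

(** The second block of the variable is unconstrained, so normals to the
    product set vanish there. *)
Lemma normal_cone_Kset z (u : 'cV[R]_(n + m)) :
  normal_cone (Kset Omega) z u <->
  normal_cone Omega (usubmx z) (usubmx u) /\ dsubmx u = 0.
Proof.
have dot (a b : 'cV[R]_(n + m)) : (a^T *m b) 0 0 =
    ((usubmx a)^T *m usubmx b) 0 0 + ((dsubmx a)^T *m dsubmx b) 0 0.
  by rewrite -{1}(vsubmxK a) -{1}(vsubmxK b) tr_col_mx mul_row_col mxE.
split => [[Kz uz]|[[Oz uz] du]]; last first.
  split=> // v Kv; rewrite dot du trmx0 mul0mx [X in _ + X]mxE addr0 usubmxB.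
  exact: uz.
split; first split=> // v Ov.
  have := uz (col_mx v (dsubmx z)); rewrite dot !(usubmxB, dsubmxB).
  rewrite col_mxKu col_mxKd subrr mulmx0 [X in _ + X]mxE addr0; apply.
  by rewrite /Kset /= col_mxKu.
(* moving the unconstrained block of z along that of u *)
have := uz (col_mx (usubmx z) (dsubmx z + dsubmx u)); rewrite dot !(usubmxB, dsubmxB).
rewrite col_mxKu col_mxKd subrr mulmx0 [X in X + _ <= _]mxE add0r addrAC subrr add0r.
move=> H; apply: l2norm_eq0; rewrite /l2norm -[leRHS]sqrtr0 ler_wsqrtr//.
have {H} : ((dsubmx u)^T *m dsubmx u) 0 0 <= 0 by apply: H; rewrite /Kset /= col_mxKu.
by rewrite mxE; under eq_bigr do rewrite mxE -expr2.
Qed.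

Lemma Lmap_normal_cone xhat z xi (delta : 'cV[R]_(n + m)) :
  Lmap c g Omega M xhat z xi delta <->
  normal_cone (Kset Omega) z (delta - phi_hat c g M z xhat xi).
Proof.
split=> [[u Nu <-]|N]; first by rewrite addrAC subrr add0r.
by exists (delta - phi_hat c g M z xhat xi); rewrite // addrC subrK.
Qed.

(** Perturbing the data of a subproblem amounts to perturbing the right-hand
    side of the reference generalized equation. *)
Lemma KKT_cvx_Linv xhat xbar z xi xi' :
  KKT_cvx c g Omega M xhat xi z <->
  Linv c g Omega M xbar
    (phi_hat c g M z xbar xi' - phi_hat c g M z xhat xi) xi' z.
Proof.
rewrite /KKT_cvx /Linv /=.
split=> /Lmap_normal_cone N; apply/Lmap_normal_cone; move: N.
  by rewrite addrAC subrr.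
by rewrite addrAC subrr.
Qed.

Lemma KKT_cvxP xhat xi z : KKT_cvx c g Omega M xhat xi z <->
  normal_cone Omega (usubmx z) (- (c + (Jac g xhat)^T *m dsubmx z)) /\
  g xhat + Jac g xhat *m (usubmx z - xhat) + M *m xi = 0.
Proof.
rewrite /KKT_cvx /=; split.
  move=> /Lmap_normal_cone/normal_cone_Kset.
  rewrite sub0r /phi_hat opp_col_mx col_mxKu col_mxKd => -[N /eqP].
  by rewrite oppr_eq0 => /eqP.
move=> [N E]; apply/Lmap_normal_cone/normal_cone_Kset.
by rewrite sub0r /phi_hat opp_col_mx col_mxKu col_mxKd E oppr0.
Qed.

(** The linearization is exact, in value and in derivative, at its base
    point. *)
Lemma KKT_KKT_cvx xi z :
  KKT c g Omega M xi z <-> KKT_cvx c g Omega M (usubmx z) xi z.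
Proof.
split.
  move=> [[u Nu Eu] E]; apply/KKT_cvxP; rewrite subrr mulmx0 addr0; split=> //.
  suff <- : u = - (c + (Jac g (usubmx z))^T *m dsubmx z) by [].
  by apply/eqP; rewrite -addr_eq0 addrC Eu.
move=> /KKT_cvxP; rewrite subrr mulmx0 addr0 => -[N E]; split=> //.
by exists (- (c + (Jac g (usubmx z))^T *m dsubmx z)); rewrite ?subrr.
Qed.

Lemma phi_hatB xhat z z' xi :
  phi_hat c g M z xhat xi - phi_hat c g M z' xhat xi =
  col_mx ((Jac g xhat)^T *m dsubmx (z - z')) (Jac g xhat *m usubmx (z - z')).
Proof.
rewrite /phi_hat opp_col_mx add_col_mx usubmxB dsubmxB !mulmxBr; congr (col_mx _ _).
  by apply/colP => i; rewrite !mxE; ring.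
by apply/colP => i; rewrite !mxE; ring.
Qed.

Lemma phi_hat_param xhat z xi xi' :
  phi_hat c g M z xhat xi' - phi_hat c g M z xhat xi =
  col_mx 0 (M *m (xi' - xi)).
Proof.
rewrite /phi_hat opp_col_mx add_col_mx subrr (mulmxBr M); congr (col_mx _ _).
by rewrite opprD addrACA subrr add0r.
Qed.

(** The minimizers of a convex problem all pair with the same multipliers:
    the feasible direction between two of them is orthogonal to c, so a
    multiplier of one is a multiplier of the other. *)
Lemma KKT_cvx_segment xhat xi z z' : convex_set Omega ->
  KKT_cvx c g Omega M xhat xi z -> KKT_cvx c g Omega M xhat xi z' ->
  forall t, 0 <= t <= 1 -> KKT_cvx c g Omega M xhat xi (z + t *: (z' - z)).
Proof.
move=> convO /KKT_cvxP[[Oz Nz] Ez] /KKT_cvxP[[Oz' Nz'] Ez'] t /andP[t0 t1].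
have t1' : 0 <= 1 - t by rewrite subr_ge0.
set A := Jac g xhat in Nz Nz' Ez Ez' *.
pose dot (a b : 'cV[R]_n) := (a^T *m b) 0 0.
have dotE a b : dot a b = \sum_i a i 0 * b i 0.
  by rewrite /dot mxE; apply: eq_bigr => i _; rewrite mxE.
have dotC a b : dot a b = dot b a.
  by rewrite !dotE; apply: eq_bigr => i _; rewrite mulrC.
have dotD a b b' : dot a (b + b') = dot a b + dot a b'.
  by rewrite /dot mulmxDr mxE.
have dotZ a b s : dot a (s *: b) = s * dot a b by rewrite /dot -scalemxAr mxE.
have dotN a b : dot a (- b) = - dot a b by rewrite /dot mulmxN mxE.
have Axx' : A *m (usubmx z' - usubmx z) = 0.
  have -> : usubmx z' - usubmx z = (usubmx z' - xhat) - (usubmx z - xhat).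
    by rewrite opprB addrA subrK.
  rewrite mulmxBr; apply/eqP; rewrite subr_eq0; apply/eqP.
  by apply: (addrI (g xhat)); apply: (addIr (M *m xi)); rewrite Ez Ez'.
have dotA l : dot (A^T *m l) (usubmx z' - usubmx z) = 0.
  by rewrite /dot trmx_mul trmxK -mulmxA Axx' mulmx0 mxE.
apply/KKT_cvxP; rewrite -/A; split; last first.
  have -> : usubmx (z + t *: (z' - z)) = usubmx z + t *: (usubmx z' - usubmx z).
    by rewrite linearD /= linearZ /= linearB.
  rewrite [_ + _ - xhat]addrAC mulmxDr -scalemxAr Axx' scaler0 addr0.
  exact: Ez.
set x := usubmx z in Oz Nz Ez Axx' dotA *.
set x' := usubmx z' in Oz' Nz' Ez' Axx' dotA *.
set l := dsubmx z in Nz *; set l' := dsubmx z' in Nz' *.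
have -> : usubmx (z + t *: (z' - z)) = x + t *: (x' - x).
  by rewrite linearD /= linearZ /= linearB.
have -> : dsubmx (z + t *: (z' - z)) = l + t *: (l' - l).
  by rewrite linearD /= linearZ /= linearB.
split.
  have := convO x' x (Itv01 t0 t1); rewrite !inE => /(_ Oz' Oz).
  congr (Omega _); rewrite /conv /=.
  by apply/colP => i; rewrite !mxE /unstable.onem; ring.
move=> v Ov.
have dotDl a a' b : dot (a + a') b = dot a b + dot a' b.
  by rewrite dotC dotD !(dotC b).
have dotZl a b s : dot (s *: a) b = s * dot a b by rewrite dotC dotZ dotC.
have dotNl a b : dot (- a) b = - dot a b by rewrite dotC dotN dotC.
have {}Nz w : Omega w -> 0 <= dot (c + A^T *m l) (w - x).
  by move=> /Nz; rewrite -/(dot _ _) dotNl oppr_le0.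
have {}Nz' w : Omega w -> 0 <= dot (c + A^T *m l') (w - x').
  by move=> /Nz'; rewrite -/(dot _ _) dotNl oppr_le0.
have -> : c + A^T *m (l + t *: (l' - l)) =
    (1 - t) *: (c + A^T *m l) + t *: (c + A^T *m l').
  rewrite mulmxDr -scalemxAr mulmxBr.
  by apply/colP => i; rewrite !mxE; ring.
have cA (k : 'cV[R]_m) : dot (c + A^T *m k) (x' - x) = dot c (x' - x).
  by rewrite dotDl dotA addr0.
have := Nz _ Oz'; have := Nz' _ Oz; have := Nz _ Ov; have := Nz' _ Ov.
have -> : x - x' = - (x' - x) by rewrite opprB.
have -> : v - x' = (v - x) + - (x' - x) by rewrite opprB addrA subrK.
have -> : v - (x + t *: (x' - x)) = (v - x) + - (t *: (x' - x)) by rewrite opprD addrA.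
rewrite -/(dot _ _) dotNl oppr_le0 [dot (_ *: _ + _) _]dotDl !dotZl.
move: (x' - x) (v - x) cA => h w cA; rewrite !(dotD, dotN, dotZ) !cA.
move: (dot c _) (dot _ w) (dot _ w) => ch a b h1 h2 h3 h4.
have ch0 : ch = 0 by lra.
move: h1; rewrite ch0 mulr0 !subr0 => h1.
by rewrite addr_ge0// mulr_ge0.
Qed.

End kkt.

(** * Dependence of the linearization on its base point *)

Section linearization_estimates.
Context {R : realType} {n m p : nat}.
Variables (c : 'cV[R]_n) (g : 'cV[R]_n -> 'cV[R]_m) (M : 'M[R]_(m, p)).
Hypothesis C2g : forall i : 'I_m, C2 (component g i).
Implicit Types (x : 'cV[R]_n) (z : 'cV[R]_(n + m)) (xi : 'cV[R]_p).

Lemma frobenius_norm_le k l (A : 'M[R]_(k, l)) (e : R) :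
  0 <= e -> (forall i j, `|A i j| <= e) -> frobenius_norm A <= (k * l)%:R * e.
Proof.
move=> e0 Ae.
rewrite -(ler_pXn2r (n := 2))// ?nnegrE ?mulr_ge0 ?frobenius_norm_ge0//.
rewrite frobenius_norm_sqr exprMn.
apply: (@le_trans _ _ (\sum_(i < k) \sum_(j < l) e ^+ 2)).
  do 2![apply: ler_sum => ? _].
  by rewrite -(real_normK (num_real _)) ler_pXn2r// nnegrE.
rewrite !sumr_const !card_ord -mulrnA -[leLHS]mulr_natl ler_wpM2r ?sqr_ge0//.
by rewrite -natrX ler_nat mulnC; case: (k * l)%N => // q; rewrite leq_pmulr.
Qed.

Lemma Jac_near x0 eps : 0 < eps ->
  \forall x \near x0, frobenius_norm (Jac g x0 - Jac g x) <= eps.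
Proof.
move=> eps0; set e := eps / (m * n).+1%:R.
have e0 : 0 < e by rewrite divr_gt0.
have : \forall x \near x0, forall i j, `|(Jac g x0 - Jac g x) i j| <= e.
  apply: (@filter_forall _ _ _ _ (nbhs_filter x0)) => i.
  apply: (@filter_forall _ _ _ _ (nbhs_filter x0)) => j.
  have [[_ cj] _] := C2g i.
  have /cvgr_dist_le/(_ _ e0) := cj j x0.
  by apply: filterS => x; rewrite !mxE.
apply: filterS => x xe; apply: le_trans (frobenius_norm_le (ltW e0) xe) _.
by rewrite /e mulrCA ler_piMr ?(ltW eps0)// ler_pdivrMr// mul1r ler_nat.
Qed.

(** For a fixed linearization point phi_hat is affine in z with matrix built
    from the Jacobian there, which is close to the Jacobian at x0. *)
Lemma phi_hat_relinearize x0 eps : 0 < eps ->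
  \forall x \near x0, forall z z' xi xi',
    l2norm ((phi_hat c g M z x0 xi - phi_hat c g M z x xi') -
            (phi_hat c g M z' x0 xi - phi_hat c g M z' x xi')) <=
    eps * l2norm (z - z').
Proof.
move=> eps0; have := Jac_near x0 eps0; apply: filterS => x xe z z' xi xi'.
have -> : (phi_hat c g M z x0 xi - phi_hat c g M z x xi') -
    (phi_hat c g M z' x0 xi - phi_hat c g M z' x xi') =
  col_mx ((Jac g x0 - Jac g x)^T *m dsubmx (z - z'))
         ((Jac g x0 - Jac g x) *m usubmx (z - z')).
  have sub4 (a b a' b' : 'cV[R]_(n + m)) : a - b - (a' - b') = a - a' - (b - b').
    by rewrite !opprD !opprK addrACA.
  rewrite sub4.
  rewrite !phi_hatB opp_col_mx add_col_mx -!mulmxBl.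
  by rewrite [(_ - _)^T]linearB.
apply: le_trans (l2norm_col_mx_mulmx _ _) _.
by rewrite ler_wpM2r// l2norm_ge0.
Qed.

Lemma phi_hatEu z x xi j : phi_hat c g M z x xi (lshift m j) 0 =
  c j 0 + \sum_i partial j (component g i) x * dsubmx z i 0.
Proof.
rewrite /phi_hat col_mxEu !mxE; congr (_ + _).
by apply: eq_bigr => i _; rewrite !mxE.
Qed.

Lemma phi_hatEd z x xi i : phi_hat c g M z x xi (rshift n i) 0 =
  component g i x + \sum_j partial j (component g i) x * (usubmx z - x) j 0
  + (M *m xi) i 0.
Proof.
rewrite /phi_hat col_mxEd mxE [X in X + _]mxE; congr (_ + _ + _).
by rewrite mxE; apply: eq_bigr => j _; rewrite [Jac _ _ _ _]mxE.
Qed.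

Lemma E_g_mulE z (h : 'cV[R]_n) j : ((E_g g z)^T *m h) j 0 =
  \sum_i dsubmx z i 0 *
    \sum_k partial k (partial j (component g i)) (usubmx z) * h k 0.
Proof.
rewrite mxE; under [RHS]eq_bigr do rewrite mulr_sumr.
rewrite exchange_big; apply: eq_bigr => k _ /=.
rewrite mxE /E_g summxE mulr_suml; apply: eq_bigr => i _.
by rewrite mxE [hessian _ _ _ _]mxE mulrA.
Qed.

(** The second derivatives of g enter the first block through the multipliers
    and give the transpose of E_g.  In the second block the derivative of
    g(u) + g'(u)(x - u) in u vanishes at u = x.  All other terms are products
    of an increment that is O(u - v) with a factor that tends to 0. *)
Lemma phi_hat_strict_diff z0 T (F : filter_on T)
    (zf : T -> 'cV[R]_(n + m)) (u v : T -> 'cV[R]_n) xi k :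
  zf @ F --> z0 -> u @ F --> usubmx z0 -> v @ F --> usubmx z0 ->
  (fun w => (phi_hat c g M (zf w) (u w) xi - phi_hat c g M (zf w) (v w) xi
     - col_mx ((E_g g z0)^T *m (u w - v w)) 0) k 0) =o_F (fun w => u w - v w).
Proof.
move=> cz cu cv.
have entryB d (a b : 'cV[R]_d) i : (a - b) i 0 = a i 0 - b i 0 by rewrite !mxE.
have coordF d (f : T -> 'cV[R]_d) (l : 'cV[R]_d) i :
    f @ F --> l -> (fun w => f w i 0) @ F --> l i 0.
  move=> fl; apply: (@cvg_comp _ _ _ f (fun y : 'cV[R]_d => y i 0) _ _ _ fl).
  exact: coord_continuous.
have usub_cvg j : (fun w => usubmx (zf w) j 0) @ F --> usubmx z0 j 0.
  by under eq_cvg do rewrite mxE; rewrite mxE; exact: coordF.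
have dsub_cvg i : (fun w => dsubmx (zf w) i 0) @ F --> dsubmx z0 i 0.
  by under eq_cvg do rewrite mxE; rewrite mxE; exact: coordF.
have partial_cvg i j : (fun w => partial j (component g i) (v w)) @ F -->
    partial j (component g i) (usubmx z0).
  have [[_ cj] _] := C2g i.
  by apply: (@cvg_comp _ _ _ v (partial j (component g i)) _ _ _ cv); exact: cj.
have partialO i j : (fun w => partial j (component g i) (u w)
    - partial j (component g i) (v w)) =O_F (fun w => u w - v w).
  by have [_ /(_ j) C1ij] := C2g i; exact: C1_bigO C1ij cu cv.
case: (split_ordP k) => [j ->|i ->].
  pose d i w := partial j (component g i) (u w) - partial j (component g i) (v w).
  have -> : (fun w => (phi_hat c g M (zf w) (u w) xi - phi_hat c g M (zf w) (v w) xi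
     - col_mx ((E_g g z0)^T *m (u w - v w)) 0) (lshift m j) 0) =
    (fun w => \sum_i ((dsubmx (zf w) i 0 - dsubmx z0 i 0) * d i w +
       dsubmx z0 i 0 * (d i w -
         \sum_k partial k (partial j (component g i)) (usubmx z0) * (u w - v w) k 0))).
    apply/funext => w; rewrite !entryB.
    rewrite !phi_hatEu col_mxEu E_g_mulE opprD addrACA subrr add0r -!sumrB.
    by apply: eq_bigr => i _; rewrite /d; ring.
  apply: littleo_sum => i; apply: littleoD.
    apply: cvg0_bigO_littleo (partialO i j).
    rewrite -[X in _ --> X](subrr (dsubmx z0 i 0)).
    by apply: cvgB; [exact: dsub_cvg|exact: cvg_cst].
  apply: littleoMl; have [_ /(_ j) C1ij] := C2g i.
  exact: C1_strict_diff C1ij cu cv.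
have [C1i _] := C2g i.
pose d j w := partial j (component g i) (u w) - partial j (component g i) (v w).
have -> : (fun w => (phi_hat c g M (zf w) (u w) xi - phi_hat c g M (zf w) (v w) xi
     - col_mx ((E_g g z0)^T *m (u w - v w)) 0) (rshift n i) 0) =
  (fun w => (component g i (u w) - component g i (v w) -
      \sum_j partial j (component g i) (usubmx z0) * (u w - v w) j 0) +
    \sum_j ((usubmx (zf w) - u w) j 0 * d j w +
      (partial j (component g i) (usubmx z0) - partial j (component g i) (v w))
        * (u w - v w) j 0)).
  apply/funext => w; rewrite !entryB.
  rewrite !phi_hatEd col_mxEd [X in _ - X]mxE subr0.
  rewrite -[RHS]addrA [X in _ = _ + X]addrC -sumrB.
  transitivity ((component g i (u w) - component g i (v w)) +
    \sum_j (partial j (component g i) (u w) * (usubmx (zf w) - u w) j 0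
          - partial j (component g i) (v w) * (usubmx (zf w) - v w) j 0)).
    by rewrite sumrB; ring.
  congr (_ + _); apply: eq_bigr => j _; rewrite /d.
  by rewrite !entryB; ring.
apply: littleoD; first exact: C1_strict_diff C1i cu cv.
apply: littleo_sum => j; apply: littleoD.
  apply: cvg0_bigO_littleo (partialO i j).
  have -> : (fun w => (usubmx (zf w) - u w) j 0) =
      (fun w => usubmx (zf w) j 0 - u w j 0).
    by apply/funext => w; rewrite entryB.
  rewrite -[X in _ --> X](subrr (usubmx z0 j 0)).
  by apply: cvgB; [exact: usub_cvg|exact: coordF].
apply: cvg0_bigO_littleo (coord_bigO _ _ _).
rewrite -[X in _ --> X](subrr (partial j (component g i) (usubmx z0))).
by apply: cvgB; [exact: cvg_cst|exact: partial_cvg].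
Qed.

End linearization_estimates.

Section phi_hat_estimates.
Context {R : realType} {n m p : nat}.
Variables (c : 'cV[R]_n) (g : 'cV[R]_n -> 'cV[R]_m) (M : 'M[R]_(m, p)).
Hypothesis C2g : forall i : 'I_m, C2 (component g i).

Lemma phi_hat_recenter_near (z0 : 'cV[R]_(n + m)) (xi : 'cV[R]_p) eps : 0 < eps ->
  \forall w \near (z0, (usubmx z0, usubmx z0)),
    l2norm (phi_hat c g M w.1 w.2.1 xi - phi_hat c g M w.1 w.2.2 xi) <=
    (frobenius_norm (E_g g z0) + eps) * l2norm (w.2.1 - w.2.2).
Proof.
move=> eps0; set w0 := (z0, (usubmx z0, usubmx z0)).
have cz : (fst : _ -> 'cV[R]_(n + m)) @ w0 --> z0 by exact: cvg_fst.
have cu : (fun w : 'cV[R]_(n + m) * ('cV[R]_n * 'cV[R]_n) => w.2.1) @ w0 --> usubmx z0.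
  by apply: (@cvg_comp _ _ _ snd fst _ (nbhs (usubmx z0, usubmx z0)));
    [exact: cvg_snd|exact: cvg_fst].
have cv : (fun w : 'cV[R]_(n + m) * ('cV[R]_n * 'cV[R]_n) => w.2.2) @ w0 --> usubmx z0.
  by apply: (@cvg_comp _ _ _ snd snd _ (nbhs (usubmx z0, usubmx z0)));
    [exact: cvg_snd|exact: cvg_snd].
have := l2norm_littleo (fun k => phi_hat_strict_diff c M C2g xi k cz cu cv) eps0.
apply: filterS => w /= wE.
rewrite -[X in l2norm X](subrK (col_mx ((E_g g z0)^T *m (w.2.1 - w.2.2)) 0)).
apply: le_trans (l2normD _ _) _; rewrite addrC mulrDl lerD// l2norm_col_mx0.
by apply: le_trans (l2norm_mulmx _ _) _; rewrite frobenius_norm_tr.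
Qed.

(** Quantified over balls, so that one radius serves both estimates and every
    parameter: xi enters phi_hat additively and cancels. *)
Lemma phi_hat_estimates (z0 : 'cV[R]_(n + m)) eps : 0 < eps ->
  exists2 r, 0 < r &
    (forall x, l2ball (usubmx z0) r x -> forall z z' xi xi',
      l2norm ((phi_hat c g M z (usubmx z0) xi - phi_hat c g M z x xi') -
              (phi_hat c g M z' (usubmx z0) xi - phi_hat c g M z' x xi')) <=
      eps * l2norm (z - z')) /\
    (forall z u v xi,
      l2ball z0 r z -> l2ball (usubmx z0) r u -> l2ball (usubmx z0) r v ->
      l2norm (phi_hat c g M z u xi - phi_hat c g M z v xi) <=
      (frobenius_norm (E_g g z0) + eps) * l2norm (u - v)).
Proof.
move=> eps0.
have [r1 r10 H1] :=
  iffLR (nbhs_l2ball _ _) (phi_hat_relinearize c M C2g (usubmx z0) eps0).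
have [r2 /= r20 H2] :=
  iffLR (nbhs_ballP _ _) (phi_hat_recenter_near z0 0 eps0).
have in_ball d (y y0 : 'cV[R]_d) : l2ball y0 (Num.min r1 (r2 / 2)) y -> ball y0 r2 y.
  rewrite /l2ball /= => yr; rewrite -ball_normE /= distrC.
  apply: le_lt_trans (norm_le_l2norm _) _; apply: le_lt_trans yr _.
  by rewrite gt_min ltr_pdivrMr// ltr_pMr// ltr1n orbT.
exists (Num.min r1 (r2 / 2)); first by rewrite lt_min r10 divr_gt0.
split=> [x xr|z u v xi zr ur vr].
  by apply: H1; apply: le_trans xr _; rewrite ge_min lexx.
have E0 x : phi_hat c g M z x xi = phi_hat c g M z x 0 + col_mx 0 (M *m (xi - 0)).
  by rewrite -(phi_hat_param c g M x z) addrC subrK.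
rewrite (E0 u) (E0 v) opprD addrACA subrr addr0.
apply: (H2 (z, (u, v))); split; first exact: in_ball.
by split; exact: in_ball.
Qed.

End phi_hat_estimates.

(** * Perturbation of a strongly regular solution *)

(** Robinson's perturbation argument.  When S is the inverse of a set-valued
    map with a gamma-Lipschitz localization psi, solving z \in S (D z) near z0
    means solving z = psi (D z), a contraction as soon as D is Lipschitz with a
    constant below 1/gamma.  The bound gamma * b < r keeps psi o D inside the
    ball, and strictly so. *)
Lemma localization_perturbation {R : realType} d (z0 : 'cV[R]_d) (r gamma q b : R)
    (S : 'cV[R]_d -> set 'cV[R]_d) (N0 N : set 'cV[R]_d)
    (psi D : 'cV[R]_d -> 'cV[R]_d) :
  0 < gamma -> 0 <= q -> gamma * q < 1 -> 0 <= r -> gamma * b < r ->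
  l2ball 0 b `<=` N0 -> l2ball z0 r `<=` N -> N0 0 -> psi 0 = z0 ->
  (forall delta, N0 delta -> N `&` S delta = [set psi delta]) ->
  (forall delta delta', N0 delta -> N0 delta' ->
     l2norm (psi delta - psi delta') <= gamma * l2norm (delta - delta')) ->
  (forall z, l2ball z0 r z -> l2ball 0 b (D z)) ->
  (forall z w, l2ball z0 r z -> l2ball z0 r w ->
     l2norm (D z - D w) <= q * l2norm (z - w)) ->
  exists z, [/\ l2norm (z - z0) < r, S (D z) z, z = psi (D z) &
    forall w, l2ball z0 r w -> S (D w) w -> w = z].
Proof.
move=> g0 q0 gq1 r0 gb bN0 rN N00 psi0 NS lip Db Dlip.
have psi_lt z : l2ball z0 r z -> l2norm (psi (D z) - z0) < r.
  move=> Bz; rewrite -{1}psi0; apply: le_lt_trans gb.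
  apply: le_trans (lip _ _ (bN0 _ (Db _ Bz)) N00) _.
  by rewrite ler_wpM2l ?(ltW g0)//; exact: Db.
have psi_lip z w : l2ball z0 r z -> l2ball z0 r w ->
    l2norm (psi (D z) - psi (D w)) <= gamma * q * l2norm (z - w).
  move=> Bz Bw; apply: le_trans (lip _ _ (bN0 _ (Db _ Bz)) (bN0 _ (Db _ Bw))) _.
  by rewrite -mulrA ler_wpM2l ?(ltW g0)// Dlip.
have gq0 : 0 <= gamma * q by rewrite mulr_ge0// ltW.
have [z Bz zE] := @l2_fixed_point R d z0 r (gamma * q) (psi \o D) r0 gq0 gq1
  (fun z Bz => ltW (psi_lt z Bz)) psi_lip.
exists z; split=> //; first by rewrite [X in X - _]zE psi_lt.
  have : (N `&` S (D z)) (psi (D z)) by rewrite NS//; exact/bN0/Db.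
  by move=> [_]; rewrite -[psi (D z)]zE.
move=> w Bw Sw.
have {Sw} wE : w = psi (D w).
  have : (N `&` S (D w)) w by split => //; exact: rN.
  by rewrite NS//; exact/bN0/Db.
apply/subr0_eq/l2norm_eq0; have := psi_lip _ _ Bw Bz.
rewrite -wE -[psi (D z)]zE; have := l2norm_ge0 (w - z); nra.
Qed.

(** * The parametric sequential convex programming step *)

Theorem theorem1 (R : realType) (n m p : nat)
  (c : 'cV[R]_n) (g : 'cV[R]_n -> 'cV[R]_m) (Omega : set 'cV[R]_n)
  (Gamma : set 'cV[R]_p) (M : 'M[R]_(m, p))
  (convex_Omega : convex_set Omega)
  (k : nat) (xi0 xik : 'cV[R]_p)
  (Gamma_xi0 : Gamma xi0) (Gamma_xik : Gamma xik)
  (xik_xi0 : k = 0%N -> xik = xi0)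
  (zbark : 'cV[R]_(n + m)) (KKT_zbark : KKT c g Omega M xik zbark)
  (A1 : KKT c g Omega M xi0 !=set0)
  (A2 : forall i : 'I_m, C2 (component g i))
  (gamma : R) (gamma_gt0 : 0 < gamma)
  (A3 : strong_regularity c g Omega M zbark xik gamma)
  (A4 : exists kappa : R,
      [/\ 0 <= kappa, kappa < 1 / gamma & frobenius_norm (E_g g zbark) <= kappa]) :
  exists (Ntau : set 'cV[R]_p) (Nrho : set 'cV[R]_(n + m))
         (zbar : 'cV[R]_p -> 'cV[R]_(n + m)),
    [/\ Ntau `<=` Gamma, within Gamma (nbhs xik) Ntau, nbhs zbark Nrho,
        (forall xi, Ntau xi -> Nrho `&` KKT c g Omega M xi = [set zbar xi]) &
        exists omegak ck : R,
          [/\ 0 < omegak, omegak < 1, 0 < ck &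
            forall xi zk, Ntau xi -> Nrho zk ->
              (exists z, KKT_cvx c g Omega M (usubmx zk) xi z) /\
              (forall z, KKT_cvx c g Omega M (usubmx zk) xi z ->
                 l2norm (z - zbar xi) <=
                   omegak * l2norm (zk - zbark)
                   + ck * l2norm (M *m (xi - xik)))]].
Proof.
have [kappa [kappa0 kappa_lt Ekappa]] := A4.
have [N0 [Nz [psi [nbhsN0 nbhsNz psiE psi_lip]]]] := A3.
set xbar := usubmx zbark in psiE *.
set phi := phi_hat c g M.
have gk1 : gamma * kappa < 1 by rewrite mulrC -ltr_pdivlMr.
(* half of the slack 1 - gamma * kappa pays for the linearization errors *)
pose eps := (1 - gamma * kappa) / (4 * gamma).
have eps0 : 0 < eps by rewrite divr_gt0 ?mulr_gt0// subr_gt0.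
have geps : gamma * eps = (1 - gamma * kappa) / 4.
  by rewrite /eps; field; rewrite gt_eqF.
pose q := kappa + 2 * eps.
have q0 : 0 <= q by rewrite addr_ge0// mulr_ge0// ltW.
have gq1 : gamma * q < 1 by rewrite /q mulrDr mulrCA geps; lra.
have [r0 r00 [relin recenter0]] := phi_hat_estimates c M A2 zbark eps0.
have recenter z u v xi : l2ball zbark r0 z -> l2ball xbar r0 u -> l2ball xbar r0 v ->
    l2norm (phi z u xi - phi z v xi) <= (kappa + eps) * l2norm (u - v).
  move=> Bz Bu Bv; apply: le_trans (recenter0 z u v xi Bz Bu Bv) _.
  by rewrite ler_wpM2r ?l2norm_ge0// lerD2r.
have [r1 r10 r1N] := iffLR (nbhs_l2ball _ _) nbhsNz.
have [r2 r20 r2N] := iffLR (nbhs_l2ball _ _) nbhsN0.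
pose r := Num.min r0 (Num.min r1 (gamma * r2)).
have rgt0 : 0 < r by rewrite !lt_min r00 r10 mulr_gt0.
have rr0 : r <= r0 by rewrite ge_min lexx.
have rr1 : r <= r1 by rewrite !ge_min lexx orbT.
have rr2 : r <= gamma * r2 by rewrite !ge_min lexx !orbT.
(* tau makes gamma * b the midpoint of gamma * q * r and r, strictly below r:
   the solutions stay in the interior of the ball. *)
pose tau := (1 - gamma * q) * r / (2 * gamma).
have tau0 : 0 < tau by rewrite divr_gt0 ?mulr_gt0// subr_gt0.
pose b := q * r + tau.
have gb : gamma * b < r.
  have -> : gamma * b = gamma * q * r + (1 - gamma * q) * r / 2.
    by rewrite /b /tau; field; rewrite gt_eqF.
  by have : 0 < (1 - gamma * q) * r; [rewrite mulr_gt0// subr_gt0|lra].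
have bN0 : l2ball 0 b `<=` N0.
  move=> delta db; apply: r2N; apply: le_trans db _.
  by rewrite -(ler_pM2l gamma_gt0); apply: le_trans (ltW gb) rr2.
have rNz : l2ball zbark r `<=` Nz by move=> z zr; apply: r1N; apply: le_trans zr rr1.
have N00 : N0 0 by exact: nbhs_singleton.
have sub_ball z : l2ball zbark r z -> l2ball xbar r (usubmx z).
  move=> zr; apply: le_trans zr; rewrite /xbar.
  have -> : usubmx z - usubmx zbark = usubmx (z - zbark) by rewrite linearB.
  exact: l2norm_usubmx.
have ball0 d (y : 'cV[R]_d) z : l2ball y r z -> l2ball y r0 z.
  by move=> yz; apply: le_trans yz rr0.
have ball_center d (y : 'cV[R]_d) : l2ball y r y.
  by rewrite /l2ball /= subrr l2norm0 ltW.
have psi0 : psi 0 = zbark.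
  have : (Nz `&` Linv c g Omega M xbar 0 xik) zbark.
    split; first exact/rNz/ball_center.
    have /KKT_KKT_cvx/(KKT_cvx_Linv _ _ _ _ _ xbar _ _ xik) := KKT_zbark.
    by rewrite subrr.
  by rewrite psiE.
(* The generalized equation of a perturbed problem, as a perturbed right-hand
   side of the reference one. *)
pose D x xi z := phi z xbar xik - phi z x xi.
have D_param x xi z : D x xi z = D x xik z + col_mx 0 (M *m (xik - xi)).
  by rewrite -(phi_hat_param c g M x z) /D /phi subrKA.
have D_lip_cvx x xi z w : l2ball xbar r x ->
    l2norm (D x xi z - D x xi w) <= eps * l2norm (z - w).
  by move=> /ball0 Bx; exact: relin.
have D_lip_x x y xi z : l2ball zbark r z -> l2ball xbar r x -> l2ball xbar r y ->
    l2norm (D x xi z - D y xi z) <= (kappa + eps) * l2norm (x - y).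
  move=> Bz Bx By.
  have -> : D x xi z - D y xi z = phi z y xi - phi z x xi.
    by rewrite /D opprB addrC subrKA.
  by rewrite (l2distC x); apply: recenter; exact: ball0.
have D_center x xi : l2ball xbar r x ->
    l2norm (D x xi zbark) <=
    (kappa + eps) * l2norm (x - xbar) + l2norm (M *m (xi - xik)).
  move=> Bx; rewrite D_param; apply: le_trans (l2normD _ _) _.
  rewrite l2norm_col_0mx -[in X in _ + X]l2normN -mulmxN opprB lerD2r.
  by rewrite /D (l2distC x); apply: recenter; exact: ball0.
have D_lip_kkt xi z w : l2ball zbark r z -> l2ball zbark r w ->
    l2norm (D (usubmx z) xi z - D (usubmx w) xi w) <= q * l2norm (z - w).
  move=> Bz Bw; apply: le_trans (l2dist_triangle (D (usubmx z) xi w) _ _) _.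
  have -> : q * l2norm (z - w) =
      eps * l2norm (z - w) + (kappa + eps) * l2norm (z - w) by rewrite /q; ring.
  rewrite lerD//; first exact/D_lip_cvx/sub_ball.
  apply: le_trans (D_lip_x _ _ _ _ Bw (sub_ball _ Bz) (sub_ball _ Bw)) _.
  rewrite ler_wpM2l ?addr_ge0 ?(ltW eps0)//.
  have -> : usubmx z - usubmx w = usubmx (z - w) by rewrite linearB.
  exact: l2norm_usubmx.
have D_ball_kkt xi z : l2norm (M *m (xi - xik)) <= tau -> l2ball zbark r z ->
    l2ball 0 b (D (usubmx z) xi z).
  move=> txi Bz; rewrite /l2ball /= subr0.
  rewrite -[X in l2norm X](subrK (D xbar xi zbark)).
  apply: le_trans (l2normD _ _) _; rewrite lerD//.
    apply: le_trans (D_lip_kkt _ _ _ Bz (ball_center _ _)) _.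
    by rewrite ler_wpM2l.
  apply: le_trans (D_center _ _ (ball_center _ _)) _.
  by rewrite subrr l2norm0 mulr0 add0r.
have D_ball_cvx x xi z : l2norm (M *m (xi - xik)) <= tau ->
    l2ball xbar r x -> l2ball zbark r z -> l2ball 0 b (D x xi z).
  move=> txi Bx Bz; rewrite /l2ball /= subr0.
  rewrite -[X in l2norm X](subrK (D x xi zbark)).
  apply: le_trans (l2normD _ _) _.
  have -> : b = eps * r + ((kappa + eps) * r + tau) by rewrite /b /q; ring.
  rewrite lerD//.
    apply: le_trans (D_lip_cvx _ _ _ _ Bx) _.
    by rewrite ler_wpM2l ?(ltW eps0).
  apply: le_trans (D_center _ _ Bx) _; rewrite lerD//.
  by rewrite ler_wpM2l ?addr_ge0 ?(ltW eps0).
pose tauball := [set xi | l2norm (M *m (xi - xik)) <= tau].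
have solve_kkt xi : tauball xi -> exists z, [/\ l2norm (z - zbark) < r,
    KKT c g Omega M xi z, z = psi (D (usubmx z) xi z) &
    forall w, l2ball zbark r w -> KKT c g Omega M xi w -> w = z].
  move=> txi.
  have [z Bz|z w Bz Bw|z [zr Sz zE uz]] :=
    @localization_perturbation R _ zbark r gamma q b
    (fun delta => Linv c g Omega M xbar delta xik) N0 Nz psi
    (fun z => D (usubmx z) xi z) gamma_gt0 q0 gq1 (ltW rgt0) gb bN0 rNz N00 psi0
    psiE psi_lip.
  - exact: D_ball_kkt.
  - exact: D_lip_kkt.
  exists z; split=> //; first exact/KKT_KKT_cvx/(KKT_cvx_Linv _ _ _ _ _ xbar _ _ xik).
  move=> w Bw /KKT_KKT_cvx/(KKT_cvx_Linv _ _ _ _ _ xbar _ _ xik); exact: uz.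
have solve_cvx x xi : tauball xi -> l2ball xbar r x ->
    exists z, [/\ l2ball zbark r z, KKT_cvx c g Omega M x xi z,
      z = psi (D x xi z) & forall w, KKT_cvx c g Omega M x xi w -> w = z].
  move=> txi Bx.
  have [z Bz|z w Bz Bw|z [zr Sz zE uz]] :=
    @localization_perturbation R _ zbark r gamma q b
    (fun delta => Linv c g Omega M xbar delta xik) N0 Nz psi
    (D x xi) gamma_gt0 q0 gq1 (ltW rgt0) gb bN0 rNz N00 psi0 psiE psi_lip.
  - exact: D_ball_cvx.
  - apply: le_trans (D_lip_cvx _ _ _ _ Bx) _.
    by rewrite ler_wpM2r ?l2norm_ge0// /q; lra.
  have Kz : KKT_cvx c g Omega M x xi z by exact/(KKT_cvx_Linv _ _ _ _ _ xbar _ _ xik).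
  exists z; split=> //; first exact: ltW.
  (* from uniqueness in the ball to uniqueness *)
  apply: (@convex_unique R _ _ zbark z r) => //.
    by move=> w w' Kw Kw'; exact: KKT_cvx_segment.
  move=> w /(KKT_cvx_Linv _ _ _ _ _ xbar _ _ xik) Kw Bw; exact: uz.
(* zbark is a default value, taken only outside tauball *)
pose zbar xi := xget zbark (l2ball zbark r `&` KKT c g Omega M xi).
have zbarP xi : tauball xi -> [/\ l2ball zbark r (zbar xi),
    zbar xi = psi (D (usubmx (zbar xi)) xi (zbar xi)) &
    l2ball zbark r `&` KKT c g Omega M xi = [set zbar xi]].
  move=> txi; have [z [zr Kz zE uz]] := solve_kkt _ txi.
  have zball : l2ball zbark r z by exact: ltW.
  have [Bzb Kzb] : (l2ball zbark r `&` KKT c g Omega M xi) (zbar xi).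
    by apply: xgetI; split; [exact: zball|exact: Kz].
  have zbz : zbar xi = z by exact: uz.
  rewrite zbz; split=> //; apply/seteqP; split=> w /=.
    by move=> [Bw Kw]; exact: uz.
  by move=> ->; split.
exists (Gamma `&` tauball), (l2ball zbark r), zbar; split.
- by move=> xi [].
- have M0 : 0 < frobenius_norm M + 1 by rewrite ltr_wpDl ?frobenius_norm_ge0.
  apply/nbhs_l2ball; exists (tau / (frobenius_norm M + 1)); first by rewrite divr_gt0.
  move=> xi; rewrite ler_pdivlMr// => xi_near Gxi; split=> //.
  apply: le_trans (l2norm_mulmx _ _) _; apply: le_trans xi_near.
  by rewrite mulrC ler_wpM2l ?l2norm_ge0// lerDl.
- by apply/nbhs_l2ball; exists r.
- by move=> xi [_ /zbarP[]].
have g_eps1 : 0 < 1 - gamma * eps.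
  by rewrite geps; have := mulr_ge0 (ltW gamma_gt0) kappa0; lra.
have gq1' : 0 < 1 - gamma * q by rewrite subr_gt0.
have ke0 : 0 < kappa + eps by rewrite ltr_wpDl.
pose omega := gamma * (kappa + eps) / (1 - gamma * eps).
have omega0 : 0 < omega by rewrite divr_gt0// mulr_gt0.
exists omega, (omega * (gamma / (1 - gamma * q))); split=> //.
- rewrite ltr_pdivrMr// mul1r mulrDr geps; lra.
- by rewrite mulr_gt0// divr_gt0.
move=> xi zk [_ txi] Bzk.
have [z [Bz Kz zE uz]] := solve_cvx _ _ txi (sub_ball _ Bzk).
split; [by exists z | move=> w /uz -> {w}].
have [Bzb zbE _] := zbarP _ txi.
set zb := zbar xi in Bzb zbE *; set dm := l2norm (M *m _).
have D_in_cvx : N0 (D (usubmx zk) xi z) by apply/bN0/D_ball_cvx => //; exact: sub_ball.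
have D_in_kkt : N0 (D (usubmx zb) xi zb) by exact/bN0/D_ball_kkt.
have zb_near : l2norm (zb - zbark) <= gamma / (1 - gamma * q) * dm.
  have := psi_lip _ _ D_in_kkt N00; rewrite -zbE psi0 subr0.
  have : l2norm (D (usubmx zb) xi zb) <= q * l2norm (zb - zbark) + dm.
    rewrite -[X in l2norm X](subrK (D xbar xi zbark)).
    apply: le_trans (l2normD _ _) _; rewrite lerD//; first exact: D_lip_kkt.
    apply: le_trans (D_center _ _ (ball_center _ _)) _.
    by rewrite subrr l2norm0 mulr0 add0r.
  move=> /(ler_wpM2l (ltW gamma_gt0)) H1 H2.
  rewrite mulrAC ler_pdivlMr//; move: (le_trans H2 H1); lra.
(* the step from zk to z: the two fixed point equations differ by the change
   from z to zb, felt with rate eps, and by the change of linearization point *)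
have z_near : l2norm (z - zb) <= omega * l2norm (usubmx zb - usubmx zk).
  have := psi_lip _ _ D_in_cvx D_in_kkt; rewrite -zE -zbE.
  have : l2norm (D (usubmx zk) xi z - D (usubmx zb) xi zb) <=
      eps * l2norm (z - zb) + (kappa + eps) * l2norm (usubmx zb - usubmx zk).
    apply: le_trans (l2dist_triangle (D (usubmx zk) xi zb) _ _) _.
    rewrite lerD//; first exact/D_lip_cvx/sub_ball.
    rewrite (l2distC (usubmx zb)); apply: D_lip_x => //; exact: sub_ball.
  move=> /(ler_wpM2l (ltW gamma_gt0)) H1 H2.
  rewrite /omega mulrAC ler_pdivlMr//; move: (le_trans H2 H1); lra.
apply: le_trans z_near _; rewrite -mulrA -mulrDr ler_wpM2l ?(ltW omega0)//.
have -> : usubmx zb - usubmx zk = usubmx (zb - zk) by rewrite linearB.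
apply: le_trans (l2norm_usubmx _) _.
apply: le_trans (l2dist_triangle zbark _ _) _.
by rewrite addrC lerD// l2distC.
Qed.
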